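(* Let $n\ge2$, let $D\subsetneq\mathbb{R}^n$ be a domain, $x\in D$, and $t\in\left(0,\frac{\log2}{\delta_D(x)(1+\log2)}\right)$. Then $$B_k(x,r)\subset B_c(x,t)\subset B_k(x,R),$$ where $$r=\log\left(1+\frac{t\delta_D(x)}{1+t\delta_D(x)}\right)\qquad\text{and}\qquad R=\log\left(\frac{1}{2-\exp\left(\frac{t\delta_D(x)}{1-t\delta_D(x)}\right)}\right).$$ Moreover, $R/r\to1$ as $t\to0$.
   Context: $|\cdot|$ is the Euclidean norm and $\delta_D(z)=\mathrm{dist}(z,\partial D)$ is the Euclidean distance from $z$ to $\partial D$. The Cassinian metric on a domain $D\subsetneq\mathbb{R}^n$ is $$c_D(x,y)=\sup_{p\in\partial D}\frac{|x-y|}{|x-p||p-y|},\qquad x,y\in D,$$ the supremum being over the finite boundary points of $D$ (the point $\infty$, if it is a boundary point in $\overline{\mathbb{R}^n}$, contributes $0$). The quasihyperbolic metric is $$k_D(x,y)=\inf_\gamma\int_\gamma\frac{|dz|}{\delta_D(z)},$$ the infimum being over all rectifiable curves $\gamma$ in $D$ joining $x$ and $y$. The balls are $B_c(x,t)=\{y\in D:c_D(x,y)<t\}$ and $B_k(x,r)=\{y\in D:k_D(x,y)<r\}$. *)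

(* Defs.v *)
From HB Require Import structures.
From mathcomp Require Import all_boot all_order all_algebra.
From mathcomp Require Import all_classical all_reals all_analysis.

Set Implicit Arguments.
Unset Strict Implicit.
Unset Printing Implicit Defensive.

Import Order.TTheory GRing.Theory Num.Theory.
Import numFieldNormedType.Exports.

Local Open Scope classical_set_scope.
Local Open Scope ring_scope.

(* The library norm on 'rV[R]_n is the sup norm, hence a separate Euclidean
   norm.  Topological notions on 'rV[R]_n (open, connected, closure,
   continuous) are the library ones: both norms induce the same topology. *)
Definition enorm (R : realType) (n : nat) (v : 'rV[R]_n) : R :=
  Num.sqrt (\sum_(i < n) v ord0 i ^+ 2).

Definition domain (R : realType) (n : nat) (D : set 'rV[R]_n) : Prop :=
  [/\ open D, connected D & D !=set0].

Definition bdry (R : realType) (n : nat) (D : set 'rV[R]_n) : set 'rV[R]_n :=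
  closure D `\` interior D.

Definition bdist (R : realType) (n : nat) (D : set 'rV[R]_n) (z : 'rV[R]_n) :
    R :=
  inf [set enorm (z - p) | p in bdry D].

(* For a domain D other than the whole space and x, y in D, this is the
   supremum of a nonempty bounded set of reals. *)
Definition cassinian (R : realType) (n : nat) (D : set 'rV[R]_n)
    (x y : 'rV[R]_n) : R :=
  sup [set enorm (x - y) / (enorm (x - p) * enorm (p - y)) | p in bdry D].

Definition curve_length (R : realType) (n : nat) (a b : R)
    (g : R -> 'rV[R]_n) : \bar R :=
  ereal_sup [set (\sum_(0 <= i < size s)
      enorm (g (nth b (a :: s) i.+1) - g (nth b (a :: s) i)))%:E
    | s in [set s : seq R | itv_partition a b s]].

(* The arc length parametrization of g on [a, b]: the point at arc length u
   is g t, where t is the first parameter at which the length of g on [a, t]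
   reaches u. *)
Definition arc_param (R : realType) (n : nat) (a b : R)
    (g : R -> 'rV[R]_n) (u : R) : 'rV[R]_n :=
  g (inf [set t | t \in `[a, b] /\ (u%:E <= curve_length a t g)%E]).

(* The line integral of f with respect to arc length, for g rectifiable. *)
Definition line_integral (R : realType) (n : nat) (a b : R)
    (g : R -> 'rV[R]_n) (f : 'rV[R]_n -> R) : \bar R :=
  (\int[lebesgue_measure]_(u in `[0%R, fine (curve_length a b g)])
     (f (arc_param a b g u))%:E)%E.

Definition rectifiable_curve_in (R : realType) (n : nat) (D : set 'rV[R]_n)
    (a b : R) (g : R -> 'rV[R]_n) : Prop :=
  [/\ a <= b, {within `[a, b], continuous g}, g @` `[a, b] `<=` D
    & (curve_length a b g < +oo)%E].

Definition quasihyperbolic (R : realType) (n : nat) (D : set 'rV[R]_n)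
    (x y : 'rV[R]_n) : \bar R :=
  ereal_inf [set l : \bar R | exists (a b : R) (g : R -> 'rV[R]_n),
    [/\ rectifiable_curve_in D a b g, g a = x, g b = y
      & l = line_integral a b g (fun z => (bdist D z)^-1)]].

Definition ball_c (R : realType) (n : nat) (D : set 'rV[R]_n)
    (x : 'rV[R]_n) (t : R) : set 'rV[R]_n :=
  [set y | D y /\ cassinian D x y < t].

Definition ball_k (R : realType) (n : nat) (D : set 'rV[R]_n)
    (x : 'rV[R]_n) (r : R) : set 'rV[R]_n :=
  [set y | D y /\ (quasihyperbolic D x y < r%:E)%E].

Definition inner_radius (R : realType) (d t : R) : R :=
  ln (1 + t * d / (1 + t * d)).

Definition outer_radius (R : realType) (d t : R) : R :=
  ln (1 / (2 - expR (t * d / (1 - t * d)))).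

(* Main.v *)
Require Import Defs.
From HB Require Import structures.
From mathcomp Require Import all_boot all_order all_algebra.
From mathcomp Require Import all_classical all_reals all_analysis.
From mathcomp Require Import ring lra.
Import Order.TTheory GRing.Theory Num.Theory.
Import numFieldNormedType.Exports.
Local Open Scope classical_set_scope.
Local Open Scope ring_scope.
Set Implicit Arguments.
Unset Strict Implicit.
Unset Printing Implicit Defensive.

(** Write [d] for the distance from [x] to the boundary and [r] for
    [enorm (x - y)].  Both metrics are compared with [r].

    Quasihyperbolic metric.  Along a curve starting at [x], the distance to the
    boundary at arc length [u] is at most [d + u]; as the curve has length at
    least [r], integrating gives [ln (1 + r / d) <= quasihyperbolic D x y]
    ([ln_le_quasihyperbolic]).  When [r < d], the segment from [x] to [y] lies
    in [D], and the distance to the boundary at arc length [u] is at least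
    [d - u], so that [quasihyperbolic D x y <= - ln (1 - r / d)]
    ([quasihyperbolic_le_ln]).

    Cassinian metric.  By the triangle inequality, a boundary point [p]
    satisfies [enorm (x - p) * enorm (p - y) >= d * (d - r)], and a boundary
    point nearest to [x] makes this product at most [d * (d + r)].  Hence
    [r / (d * (d + r)) <= cassinian D x y <= r / (d * (d - r))]
    ([dist_lt_of_cassinian_lt], [cassinian_le]).

    The inclusions follow by elimination of [r]: the first one is exact, and
    the second one uses in addition [2 - expR s <= 1 - s].  Finally, for small
    [s = t * d], the ratio of the radii lies between [1] and
    [(1 + 2 * s) / (1 - 3 * s)] ([radius_ratio_bounds]). *)

(** * The Euclidean norm *)

Lemma enorm_ge0 (R : realType) (n : nat) (v : 'rV[R]_n) : 0 <= enorm v.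
Proof. exact: sqrtr_ge0. Qed.

Lemma sqr_enorm (R : realType) (n : nat) (v : 'rV[R]_n) :
  enorm v ^+ 2 = \sum_(i < n) v ord0 i ^+ 2.
Proof. by rewrite sqr_sqrtr// sumr_ge0// => i _; exact: sqr_ge0. Qed.

Lemma enormZ (R : realType) (n : nat) (a : R) (v : 'rV[R]_n) :
  enorm (a *: v) = `|a| * enorm v.
Proof.
rewrite -sqrtr_sqr /enorm -sqrtrM ?sqr_ge0//; congr Num.sqrt.
by rewrite mulr_sumr; apply: eq_bigr => i _; rewrite mxE exprMn.
Qed.

Lemma enormN (R : realType) (n : nat) (v : 'rV[R]_n) : enorm (- v) = enorm v.
Proof. by rewrite -scaleN1r enormZ normrN1 mul1r. Qed.

Lemma enorm_distC (R : realType) (n : nat) (u v : 'rV[R]_n) :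
  enorm (u - v) = enorm (v - u).
Proof. by rewrite -enormN opprB. Qed.

Lemma enorm0 (R : realType) (n : nat) : enorm (0 : 'rV[R]_n) = 0.
Proof. by rewrite -(scale0r 0) enormZ normr0 mul0r. Qed.

Lemma ler_coord_enorm (R : realType) (n : nat) (v : 'rV[R]_n) (i : 'I_n) :
  `|v ord0 i| <= enorm v.
Proof.
rewrite -sqrtr_sqr ler_wsqrtr// (bigD1 i)//= lerDl sumr_ge0// => j _.
exact: sqr_ge0.
Qed.

Lemma enorm_eq0 (R : realType) (n : nat) (v : 'rV[R]_n) :
  enorm v = 0 -> v = 0.
Proof.
move=> v0; apply/rowP => i; rewrite mxE; apply/eqP.
by rewrite -normr_le0 -v0 ler_coord_enorm.
Qed.

(** Cauchy-Schwarz: sum the inequalities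
    [0 <= (enorm v * u_i - enorm u * v_i) ^+ 2] over the coordinates. *)
Lemma cauchy_schwarz_enorm (R : realType) (n : nat) (u v : 'rV[R]_n) :
  \sum_(i < n) u ord0 i * v ord0 i <= enorm u * enorm v.
Proof.
have [/enorm_eq0->|u0] := eqVneq (enorm u) 0.
  by rewrite enorm0 mul0r big1// => i _; rewrite mxE mul0r.
have [/enorm_eq0->|v0] := eqVneq (enorm v) 0.
  by rewrite enorm0 mulr0 big1// => i _; rewrite mxE mulr0.
have uv0 : 0 < enorm u * enorm v.
  by rewrite mulr_gt0// lt_neqAle enorm_ge0 andbT eq_sym.
rewrite -(ler_pM2l uv0) mulr_sumr.
apply: (@le_trans _ _ (\sum_(i < n) (2^-1 * enorm v ^+ 2 * u ord0 i ^+ 2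
    + 2^-1 * enorm u ^+ 2 * v ord0 i ^+ 2))).
  apply: ler_sum => i _; rewrite -subr_ge0.
  have := sqr_ge0 (enorm v * u ord0 i - enorm u * v ord0 i).
  by set a := enorm u; set b := enorm v; lra.
by rewrite big_split/= -!mulr_sumr -!sqr_enorm; lra.
Qed.

Lemma ler_enormD (R : realType) (n : nat) (u v : 'rV[R]_n) :
  enorm (u + v) <= enorm u + enorm v.
Proof.
rewrite -ler_sqr ?nnegrE ?addr_ge0 ?enorm_ge0//.
have -> : enorm (u + v) ^+ 2 =
    enorm u ^+ 2 + enorm v ^+ 2 + 2 * \sum_(i < n) u ord0 i * v ord0 i.
  rewrite !sqr_enorm mulr_sumr -!big_split/=.
  by apply: eq_bigr => i _; rewrite mxE; ring.
by have := cauchy_schwarz_enorm u v; lra.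
Qed.

Lemma ler_enorm_dist (R : realType) (n : nat) (z u v : 'rV[R]_n) :
  enorm (u - v) <= enorm (u - z) + enorm (z - v).
Proof. by rewrite -{1}(subrKA z); exact: ler_enormD. Qed.

Lemma continuous_enormB (R : realType) (n : nat) (c : 'rV[R]_n) :
  continuous (fun v : 'rV[R]_n => enorm (v - c)).
Proof.
move=> v; rewrite /enorm; apply: continuous_comp; last exact: sqrt_continuous.
apply: (@continuous_big R^o 'I_n +%R) => [x|i _ w]; first exact: add_continuous.
have h : {for w, continuous (fun x : 'rV[R]_n => x ord0 i - c ord0 i)}.
  by apply: continuousB; [exact: coord_continuous|exact: cst_continuous].
have -> : (fun x : 'rV[R]_n => (x - c) ord0 i ^+ 2) =
    (fun x => (x ord0 i - c ord0 i) * (x ord0 i - c ord0 i)).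
  by apply/funext => x; rewrite !mxE expr2.
by apply: (@cvgM R _ _ (nbhs_filter w)); exact: h.
Qed.

(** * The distance to the boundary *)

Definition ray (R : realType) (n : nat) (x e : 'rV[R]_n) (u : R) :
  'rV[R]_n := x + u *: e.

Lemma continuous_ray (R : realType) (n : nat) (x e : 'rV[R]_n) :
  continuous (ray x e).
Proof.
move=> u; apply: cvgD; first exact: cvg_cst.
by apply: cvgZ; [exact: cvg_id|exact: cvg_cst].
Qed.

Lemma notin_bdry (R : realType) (n : nat) (D : set 'rV[R]_n) (p : 'rV[R]_n) :
  open D -> bdry D p -> ~ D p.
Proof. by move=> oD [_ nip] Dp; apply: nip; rewrite ((interior_id D).1 oD). Qed.

(** If the segment missed the boundary, then [D] and [closure D] would cut it
    in the same set, which would be relatively open and closed, nonempty and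
    proper, although a segment is connected. *)
Lemma bdry_on_segment (R : realType) (n : nat) (D : set 'rV[R]_n)
    (x z : 'rV[R]_n) : open D -> D x -> ~ D z ->
  exists2 u : R, 0 <= u <= 1 & bdry D (ray x (z - x) u).
Proof.
move=> oD Dx nDz; apply: contrapT => nob.
have cS : connected (ray x (z - x) @` `[0%R, 1%R]).
  apply: connected_continuous_connected; first exact: segment_connected.
  by apply: continuous_subspaceT; exact: continuous_ray.
suff eqS : ray x (z - x) @` `[0%R, 1%R] `&` D =
    ray x (z - x) @` `[0%R, 1%R].
  apply: nDz; suff : (ray x (z - x) @` `[0%R, 1%R] `&` D) z by case.
  rewrite eqS; exists 1; first by rewrite /= in_itv/= ler01 lexx.
  by rewrite /ray scale1r addrC subrK.
apply: cS.
- exists x; split => //; exists 0; first by rewrite /= in_itv/= ler01 lexx.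
  by rewrite /ray scale0r addr0.
- by exists D.
- exists (closure D); first exact: closed_closure.
  apply/seteqP; split => w [Sw Dw]; split => //; first exact: subset_closure.
  apply: contrapT => nDw; case: Sw => u; rewrite /= in_itv/= => u01 uw.
  apply: nob; exists u => //; rewrite uw; split => // /interior_subset.
  exact: nDw.
Qed.

Lemma bdry_neq0 (R : realType) (n : nat) (D : set 'rV[R]_n) (x : 'rV[R]_n) :
  open D -> D <> setT -> D x -> bdry D !=set0.
Proof.
move=> oD DT Dx; have [z nDz] : exists z, ~ D z.
  by apply/existsNP => allD; apply: DT; apply/seteqP; split.
by have [u _ bu] := bdry_on_segment oD Dx nDz; exists (ray x (z - x) u).
Qed.

Lemma bdist_le (R : realType) (n : nat) (D : set 'rV[R]_n) (z p : 'rV[R]_n) :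
  bdry D p -> bdist D z <= enorm (z - p).
Proof.
move=> bp; apply: ge_inf; last by exists p.
by exists 0 => _ [q _ <-]; exact: enorm_ge0.
Qed.

Lemma le_bdist (R : realType) (n : nat) (D : set 'rV[R]_n) (z : 'rV[R]_n)
    (r : R) : bdry D !=set0 -> (forall p, bdry D p -> r <= enorm (z - p)) ->
  r <= bdist D z.
Proof.
move=> [p bp] rP; apply: lb_le_inf; first by exists (enorm (z - p)), p.
by move=> _ [q bq <-]; exact: rP.
Qed.

Lemma bdist_lip (R : realType) (n : nat) (D : set 'rV[R]_n) (x z : 'rV[R]_n) :
  bdry D !=set0 -> bdist D z <= bdist D x + enorm (z - x).
Proof.
move=> bD; rewrite -lerBlDr; apply: le_bdist => // p bp.
by have := bdist_le z bp; have := ler_enorm_dist x z p; lra.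
Qed.

Lemma bdist_gt0 (R : realType) (n : nat) (D : set 'rV[R]_n) (z : 'rV[R]_n) :
  open D -> bdry D !=set0 -> D z -> 0 < bdist D z.
Proof.
move=> oD bD Dz.
have /nbhs_ballP[e /= e0 eD] : nbhs z D by exact: open_nbhs_nbhs.
apply: (lt_le_trans e0); apply: le_bdist => // p bp; rewrite leNgt.
apply/negP => zpe; apply: (notin_bdry oD bp); apply: eD; split => // i j.
rewrite (ord1 i); apply: le_lt_trans zpe.
by have := ler_coord_enorm (z - p) j; rewrite !mxE.
Qed.

Lemma mem_of_lt_bdist (R : realType) (n : nat) (D : set 'rV[R]_n)
    (x z : 'rV[R]_n) : open D -> D x -> enorm (z - x) < bdist D x -> D z.
Proof.
move=> oD Dx zx; apply: contrapT => nDz.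
have [u /andP[u0 u1] bu] := bdry_on_segment oD Dx nDz.
have := bdist_le x bu; rewrite /ray opprD addNKr enormN enormZ ger0_norm//.
by apply/negP; rewrite -ltNge (le_lt_trans _ zx)// ler_piMl// enorm_ge0.
Qed.

(** * Length and arc length parametrization *)

Lemma curve_length_ge_dist (R : realType) (n : nat) (a b : R)
    (g : R -> 'rV[R]_n) : a <= b ->
  ((enorm (g b - g a))%:E <= curve_length a b g)%E.
Proof.
rewrite le_eqVlt => /predU1P[<-|ab].
  rewrite subrr enorm0; apply: ereal_sup_ubound; exists [::] => //=.
  by rewrite big_geq.
apply: ereal_sup_ubound; exists [:: b]; first exact: itv_partition1.
by rewrite /= big_nat1.
Qed.

Lemma curve_length_ray (R : realType) (n : nat) (x e : 'rV[R]_n)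
    (a b : R) : enorm e = 1 -> a <= b ->
  curve_length a b (ray x e) = (b - a)%:E.
Proof.
move=> e1 ab.
have dist u v : u <= v -> enorm (ray x e v - ray x e u) = v - u.
  move=> uv; rewrite /ray opprD addrACA subrr add0r -scalerBl enormZ e1.
  by rewrite mulr1 ger0_norm// subr_ge0.
apply/eqP; rewrite eq_le; apply/andP; split; last first.
  by rewrite -(dist _ _ ab); exact: curve_length_ge_dist.
apply: ge_ereal_sup => _ [s sab <-]; rewrite lee_fin.
rewrite (_ : \sum_(0 <= i < size s) _ = \sum_(0 <= i < size s)
    (nth b (a :: s) i.+1 - nth b (a :: s) i)).
  by rewrite telescope_sumr// (itv_partition_nth_size b sab).
apply: eq_big_nat => i /andP[_ si]; apply: dist.
by case: sab => /pathP/(_ i si)/ltW.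
Qed.

Lemma le_at_left_end (R : realType) (h : R -> R) (a T u : R) : a < T ->
  {within `[a, T], continuous h} -> (forall t, a < t < T -> h t <= u) ->
  h T <= u.
Proof.
move=> aT /(continuous_within_itvP _ aT)[_ _ hT] hu.
apply: (cvgr_to_le hT); near=> t; apply: hu; apply/andP; split; near: t.
  exact: nbhs_left_gt.
exact: nbhs_left_lt.
Unshelve. all: by end_near. Qed.

(** The point at arc length [u] is the limit of points reached before having
    run the length [u], so that it lies within [u] of the origin. *)
Lemma arc_param_dist (R : realType) (n : nat) (a b u : R)
    (g : R -> 'rV[R]_n) : a <= b -> {within `[a, b], continuous g} ->
  0 <= u -> (u%:E <= curve_length a b g)%E ->
  exists T, [/\ T \in `[a, b], arc_param a b g u = g T &
    enorm (g T - g a) <= u].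
Proof.
move=> ab gc u0 ul; rewrite /arc_param.
set S := [set t | _]; set T := inf S; exists T.
have Sb : S b by split => //; rewrite in_itv/= ab lexx.
have Slb : lbound S a by move=> t [+ _]; rewrite in_itv/= => /andP[].
have Sinf t : S t -> T <= t by move=> St; apply: ge_inf => //; exists a.
have aT : a <= T by apply: lb_le_inf => //; exists b.
have Tb : T <= b by exact: Sinf.
split => //; first by rewrite in_itv/= aT Tb.
move: aT; rewrite le_eqVlt => /predU1P[<-|aT]; first by rewrite subrr enorm0.
apply: (@le_at_left_end _ (fun t => enorm (g t - g a)) _ _ _ aT).
  have gc' : {within `[a, T], continuous g}.
    apply: continuous_subspaceW gc => t /=; rewrite !in_itv/= => /andP[-> tT].
    exact: le_trans tT Tb.
  move=> t; apply: (@continuous_comp (subspace `[a, T]) _ _ g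
    (fun v => enorm (v - g a))); first exact: gc'.
  exact: continuous_enormB.
move=> t /andP[ta tT]; rewrite -lee_fin.
apply: (le_trans (curve_length_ge_dist g (ltW ta))); rewrite leNgt.
apply/negP => /ltW ut; move: (tT); rewrite ltNge => /negP; apply; apply: Sinf.
by split => //; rewrite in_itv/= (ltW ta) (le_trans (ltW tT))//.
Qed.

Lemma arc_param_ray (R : realType) (n : nat) (x e : 'rV[R]_n)
    (b u : R) : enorm e = 1 -> 0 <= u <= b ->
  arc_param 0 b (ray x e) u = ray x e u.
Proof.
move=> e1 /andP[u0 ub]; rewrite /arc_param; congr ray.
set S := [set t | _].
have SE : S = `[u, b]%classic.
  apply/seteqP; split => t; rewrite /S /= !in_itv/=.
    move=> [/andP[t0 ->]]; rewrite curve_length_ray// subr0 lee_fin => ->//.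
  move=> /andP[ut ->]; rewrite (le_trans u0 ut); split => //.
  by rewrite curve_length_ray ?subr0 ?lee_fin// (le_trans u0).
by rewrite SE inf_itvcc.
Qed.

(** * Comparison of integrals *)

(** The integral of a nonnegative function is a supremum over the simple
    functions below it, so it is monotone even for functions that are not
    known to be measurable, such as [z |-> (bdist D z)^-1] along an
    arbitrary rectifiable curve. *)
Lemma le_integral_patch d (T : measurableType d) (R : realType)
    (mu : {measure set T -> \bar R}) (A B : set T) (f g : T -> \bar R) :
  (forall x, A x -> (0 <= f x)%E) -> (forall x, B x -> (0 <= g x)%E) ->
  (forall x, A x -> B x /\ (f x <= g x)%E) ->
  (\int[mu]_(x in A) f x <= \int[mu]_(x in B) g x)%E.
Proof.
move=> f0 g0 fg; rewrite !ge0_integralE//; apply: ereal_sup_le => _ [h hf <-].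
exists h => // x; apply: (le_trans (hf x)); rewrite !patchE.
case: ifPn => [/set_mem /fg [Bx fgx]|_]; first by rewrite mem_set.
by case: ifPn => [/set_mem /g0|].
Qed.

(** Both logarithmic integrals, of [(d + u)^-1] and of [(d - u)^-1], are the
    cases [c = 1] and [c = -1]. *)
Lemma integral_inv_affine (R : realType) (c d r : R) : c ^+ 2 = 1 -> 0 < r ->
  (forall u, 0 <= u <= r -> 0 < d + c * u) ->
  (\int[lebesgue_measure]_(u in `[0%R, r]) ((d + c * u)^-1)%:E)%E =
  (c * (ln (d + c * r) - ln d))%:E.
Proof.
move=> c1 r0 pos.
have dF u : 0 <= u <= r ->
    is_derive u 1 (fun u : R => c * ln (d + c * u)) ((d + c * u)^-1).
  move=> /pos p; have := is_derive1_ln p => dln.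
  apply: is_derive_eq; rewrite /GRing.scale/=.
  rewrite !(scaler0, mulr0, addr0, add0r, mulr1).
  by rewrite mul1r mulrCA -expr2 c1 mulr1.
have dF' v : 0 <= v <= r ->
  derivable (fun u : R => c * ln (d + c * u)) v 1 by case/dF.
have Fc : {within `[0, r], continuous (fun u : R => c * ln (d + c * u))}.
  by apply: derivable_within_continuous => u; rewrite in_itv/=; exact: dF'.
have [_ F0 Fr] := (continuous_within_itvP _ r0).1 Fc.
rewrite (@continuous_FTC2 _ _ (fun u => c * ln (d + c * u)))//.
- by rewrite -EFinB mulr0 addr0 mulrBr.
- apply: continuous_in_subspaceT => u; rewrite inE/= in_itv/= => u0r.
  apply: cvgV; first by rewrite gt_eqF// pos.
  apply: cvgD; first exact: cvg_cst.
  by apply: cvgM; [exact: cvg_cst|exact: cvg_id].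
- split => // u; rewrite in_itv/= => /andP[u0 ur].
  by apply: dF'; rewrite !ltW.
- move=> u; rewrite in_itv/= => /andP[u0 ur].
  have /dF du : 0 <= u <= r by rewrite !ltW.
  by rewrite derive1E; exact: derive_val.
Qed.

(** * The quasihyperbolic metric *)

(** Along a curve from [x], the distance to the boundary at arc length [u] is
    at most [bdist D x + u], and the length is at least the distance between
    the endpoints. *)
Lemma ln_le_quasihyperbolic (R : realType) (n : nat) (D : set 'rV[R]_n)
    (x y : 'rV[R]_n) : open D -> D <> setT -> D x ->
  ((ln (1 + enorm (y - x) / bdist D x))%:E <= quasihyperbolic D x y)%E.
Proof.
move=> oD DT Dx; have bD := bdry_neq0 oD DT Dx.
have d0 := bdist_gt0 oD bD Dx.
apply: le_ereal_inf_tmp => _ [a [b [g [[ab gc gD gl] ga gb ->]]]].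
have yxL : ((enorm (y - x))%:E <= curve_length a b g)%E.
  by rewrite -ga -gb; exact: curve_length_ge_dist.
have Lfin : curve_length a b g \is a fin_num.
  by rewrite ge0_fin_numE// (le_trans _ yxL)// lee_fin enorm_ge0.
have arcP u : 0 <= u <= fine (curve_length a b g) ->
    0 < bdist D (arc_param a b g u) <= bdist D x + u.
  move=> /andP[u0 uL].
  have [|T [Tab -> gTx]] := arc_param_dist ab gc u0.
    by rewrite -(fineK Lfin) lee_fin.
  rewrite bdist_gt0//=; last by apply: gD; exists T.
  by apply: (le_trans (bdist_lip x (g T) bD)); rewrite lerD2l -ga.
have arc0 u : 0 <= u <= fine (curve_length a b g) ->
    (0 <= ((bdist D (arc_param a b g u))^-1)%:E)%E.
  by move=> /arcP/andP[+ _]; rewrite lee_fin invr_ge0 => /ltW.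
have := enorm_ge0 (y - x); rewrite (le_eqVlt 0) => /predU1P[<-|r0].
  by rewrite mul0r addr0 ln1 integral_ge0.
have pos u : 0 <= u <= enorm (y - x) -> 0 < bdist D x + 1 * u.
  by move=> /andP[u0 _]; rewrite mul1r ltr_pwDl.
have -> : ln (1 + enorm (y - x) / bdist D x) =
    1 * (ln (bdist D x + 1 * enorm (y - x)) - ln (bdist D x)).
  rewrite !mul1r -ln_div ?posrE ?addr_gt0//; congr ln.
  by rewrite mulrDl divff// gt_eqF.
rewrite -(integral_inv_affine _ r0 pos) ?expr1n//.
apply: le_integral_patch => // u; rewrite /= in_itv/=.
  by move=> /pos/ltW; rewrite lee_fin invr_ge0.
move=> u0r; have u0L : 0 <= u <= fine (curve_length a b g).
  case/andP: u0r => -> ur; apply: (le_trans ur).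
  by rewrite -lee_fin fineK.
have /andP[b0 bu] := arcP _ u0L.
by rewrite in_itv/= lee_fin lef_pV2 ?posrE ?pos// mul1r.
Qed.

(** The segment from [x] to [y] stays in the ball of radius [bdist D x], and
    the distance to the boundary at arc length [u] is at least
    [bdist D x - u]. *)
Lemma quasihyperbolic_le_ln (R : realType) (n : nat) (D : set 'rV[R]_n)
    (x y : 'rV[R]_n) : open D -> D <> setT -> D x ->
  enorm (y - x) < bdist D x ->
  (quasihyperbolic D x y <= (- ln (1 - enorm (y - x) / bdist D x))%:E)%E.
Proof.
move=> oD DT Dx yx; have bD := bdry_neq0 oD DT Dx.
have d0 := bdist_gt0 oD bD Dx.
have sxE e u : enorm e = 1 -> 0 <= u -> enorm (ray x e u - x) = u.
  by move=> e1 u0; rewrite /ray addrAC subrr add0r enormZ e1 mulr1 ger0_norm.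
have segD e u : enorm e = 1 -> 0 <= u < bdist D x ->
    D (ray x e u) /\ bdist D x - u <= bdist D (ray x e u).
  move=> e1 /andP[u0 ud]; split.
    by apply: (mem_of_lt_bdist oD Dx); rewrite sxE.
  rewrite lerBlDr; have := bdist_lip (ray x e u) x bD.
  by rewrite enorm_distC sxE.
have := enorm_ge0 (y - x); rewrite (le_eqVlt 0) => /predU1P[/esym yx0|r0].
  have -> : y = x by apply/eqP; rewrite -subr_eq0; apply/eqP/enorm_eq0.
  rewrite subrr enorm0 mul0r subr0 ln1 oppr0.
  have L0 : curve_length 0 0 (fun=> x) = 0%:E :> \bar R.
    apply/eqP; rewrite eq_le; apply/andP; split.
      apply: ge_ereal_sup => _ [s s00 <-].
      by rewrite (itv_partitionxx s00) big_geq.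
    have := @curve_length_ge_dist R n 0 0 (fun=> x) (lexx _).
    by rewrite subrr enorm0.
  apply: ereal_inf_lbound; exists 0, 0, (fun=> x); split => //.
  - split => //; last by rewrite L0 ltry.
      by apply: continuous_subspaceT => z; exact: cvg_cst.
    by move=> _ [u _ <-].
  - by rewrite /line_integral L0 set_itv1 integral_set1.
set r := enorm (y - x) in yx r0 *.
have rN0 : r != 0 by rewrite gt_eqF.
pose e := r^-1 *: (y - x).
have e1 : enorm e = 1 by rewrite enormZ ger0_norm ?invr_ge0 ?ltW// mulVf.
have L : curve_length 0 r (ray x e) = r%:E.
  by rewrite curve_length_ray ?subr0// ltW.
have pos u : 0 <= u <= r -> 0 < bdist D x + (-1) * u.
  by move=> /andP[_ ur]; rewrite mulN1r subr_gt0 (le_lt_trans ur).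
have -> : - ln (1 - r / bdist D x) =
    -1 * (ln (bdist D x + (-1) * r) - ln (bdist D x)).
  rewrite !mulN1r -ln_div ?posrE ?subr_gt0//; congr (- ln _).
  by rewrite mulrBl divff// gt_eqF.
rewrite -(integral_inv_affine _ r0 pos) ?sqrrN ?expr1n//.
apply: (@le_trans _ _ (line_integral 0 r (ray x e) (fun z => (bdist D z)^-1))).
  apply: ereal_inf_lbound; exists 0, r, (ray x e); split => //.
  - split; [exact: ltW| |move=> _ [u + <-]|by rewrite L ltry].
      by apply: continuous_subspaceT; exact: continuous_ray.
    rewrite /= in_itv/= => /andP[u0 ur].
    by have [] := segD e u e1; rewrite // u0 (le_lt_trans ur).
  - by rewrite /ray scale0r addr0.
  - by rewrite /ray /e scalerA divff// scale1r addrC subrK.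
have posb u : 0 <= u <= r ->
    bdist D x + (-1) * u <= bdist D (arc_param 0 r (ray x e) u).
  move=> /andP[u0 ur]; rewrite arc_param_ray ?u0// mulN1r.
  by have [] := segD e u e1; rewrite // u0 (le_lt_trans ur).
have posb0 u : 0 <= u <= r -> 0 < bdist D (arc_param 0 r (ray x e) u).
  by move=> u0r; exact: lt_le_trans (pos _ u0r) (posb _ u0r).
rewrite /line_integral L /=; apply: le_integral_patch => u; rewrite /= in_itv/=.
- by move=> /posb0/ltW; rewrite lee_fin invr_ge0.
- by move=> /pos/ltW; rewrite lee_fin invr_ge0.
move=> u0r; split => //.
by rewrite lee_fin lef_pV2 ?posrE ?pos ?posb0 ?posb.
Qed.

(** * The Cassinian metric *)

Lemma cassinian_ubound (R : realType) (n : nat) (D : set 'rV[R]_n)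
    (x y p : 'rV[R]_n) : open D -> bdry D !=set0 -> D x -> D y -> bdry D p ->
  enorm (x - y) / (enorm (x - p) * enorm (p - y)) <= cassinian D x y.
Proof.
move=> oD bD Dx Dy bp; apply: ub_le_sup; last by exists p.
exists (enorm (x - y) / (bdist D x * bdist D y)) => _ [q bq <-].
have xq := lt_le_trans (bdist_gt0 oD bD Dx) (bdist_le x bq).
have yq := lt_le_trans (bdist_gt0 oD bD Dy) (bdist_le y bq).
rewrite ler_wpM2l ?enorm_ge0// (enorm_distC q).
rewrite lef_pV2 ?posrE ?mulr_gt0 ?bdist_gt0//.
by rewrite ler_pM ?bdist_le ?ltW// bdist_gt0.
Qed.

(** At a boundary point [p] the denominator is at least
    [bdist D x * (bdist D x - enorm (x - y))]. *)
Lemma cassinian_le (R : realType) (n : nat) (D : set 'rV[R]_n)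
    (x y : 'rV[R]_n) : bdry D !=set0 -> enorm (x - y) < bdist D x ->
  cassinian D x y <=
  enorm (x - y) / (bdist D x * (bdist D x - enorm (x - y))).
Proof.
move=> [p0 bp0] xyd; apply: ge_sup.
  by exists (enorm (x - y) / (enorm (x - p0) * enorm (p0 - y))), p0.
move=> _ [p bp <-].
have d0 : 0 < bdist D x := le_lt_trans (enorm_ge0 _) xyd.
have xp := bdist_le x bp; have := ler_enorm_dist y x p.
rewrite (enorm_distC y p) => tri.
have q : bdist D x - enorm (x - y) <= enorm (p - y) by lra.
rewrite ler_wpM2l ?enorm_ge0// lef_pV2 ?posrE ?mulr_gt0 ?subr_gt0//.
- by rewrite ler_pM ?subr_ge0// ltW.
- exact: lt_le_trans d0 xp.
- by apply: lt_le_trans q; rewrite subr_gt0.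
Qed.

(** A boundary point [p] nearest to [x] would give a denominator of at most
    [bdist D x * (bdist D x + enorm (x - y))].  Since [bdist] is an
    infimum, the proof is by contradiction: if the conclusion failed, all
    boundary points would be at distance at least [k * bdist D x] from [x],
    for a fixed [k > 1]. *)
Lemma dist_lt_of_cassinian_lt (R : realType) (n : nat) (D : set 'rV[R]_n)
    (x y : 'rV[R]_n) (t : R) : open D -> bdry D !=set0 -> D x -> D y ->
  0 < t -> cassinian D x y < t ->
  enorm (x - y) < t * (bdist D x * (bdist D x + enorm (x - y))).
Proof.
move=> oD bD Dx Dy t0 ct; rewrite ltNge; apply/negP => far.
have d0 := bdist_gt0 oD bD Dx; set d := bdist D x in d0 far *.
set r := enorm (x - y) in far *; set c := cassinian D x y in ct *.
have r0 : 0 <= r := enorm_ge0 _.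
have rp : 0 < r by apply: lt_le_trans far; rewrite !mulr_gt0// ltr_pwDl.
have key p : bdry D p -> r <= c * (enorm (x - p) * (enorm (x - p) + r)).
  move=> bp; have := cassinian_ubound oD bD Dx Dy bp; rewrite -/r -/c.
  have xp := lt_le_trans (bdist_gt0 oD bD Dx) (bdist_le x bp).
  have := lt_le_trans (bdist_gt0 oD bD Dy) (bdist_le y bp).
  rewrite (enorm_distC y) => yp; rewrite ler_pdivrMr ?mulr_gt0// => h.
  have c0 : 0 < c.
    by rewrite -(pmulr_lgt0 _ (mulr_gt0 xp yp)); exact: lt_le_trans h.
  apply: (le_trans h); rewrite !ler_pM2l//.
  by have := ler_enorm_dist x p y; rewrite (enorm_distC p x).
have c0 : 0 < c.
  case: bD => p bp; rewrite -(@pmulr_lgt0 _ (enorm (x - p) * (enorm (x - p) + r))).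
    exact: lt_le_trans (key _ bp).
  have xp := lt_le_trans d0 (bdist_le x bp).
  by rewrite mulr_gt0// addr_gt0.
(* The square absorbs a factor [k] from each of [d] and [d + r]. *)
pose k := Num.sqrt (t / c).
have k2 : k ^+ 2 = t / c by rewrite sqr_sqrtr// ltW// divr_gt0.
have k1 : 1 < k.
  by rewrite -sqrtr1 ltr_sqrt ?divr_gt0// ltr_pdivlMr// mul1r.
suff : k * d <= d by apply/negP; rewrite -ltNge ltr_pMl.
apply: le_bdist => // p bp; rewrite leNgt; apply/negP => pk.
have xp0 := enorm_ge0 (x - p).
have := le_trans far (key _ bp); apply/negP; rewrite -ltNge.
have -> : t = c * k ^+ 2 by rewrite k2 mulrC divfK// gt_eqF.
rewrite -mulrA ltr_pM2l//.
have k0 : 0 < k by apply: lt_trans k1.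
apply: (@lt_le_trans _ _ (k * d * (k * d + r))).
  by rewrite ltr_pM ?ltrD2r// addr_ge0.
rewrite expr2 -!mulrA ler_pM2l// mulrCA ler_pM2l// mulrDr lerD2l.
by rewrite ler_peMl// ltW.
Qed.

(** * The radii *)

(** With [s := t * d] all the estimates of the logarithms are rational: by
    [1 + u <= expR u] and [ln (1 + u) <= u] one has
    [s / (1 + 2 * s) <= inner_radius d t <= outer_radius d t
     <= s / (1 - 3 * s)]. *)
Lemma radius_ratio_bounds (R : realType) (d t : R) : 0 < d -> 0 < t ->
  4 * (t * d) < 1 ->
  1 <= outer_radius d t / inner_radius d t <=
    (1 + 2 * (t * d)) / (1 - 3 * (t * d)).
Proof.
move=> d0 t0; rewrite /outer_radius /inner_radius.
have : 0 < t * d by rewrite mulr_gt0.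
move: (t * d) => s s0 s4.
set a := s / (1 + s); set b := s / (1 - s).
have a0 : 0 < a by rewrite divr_gt0// addr_gt0.
have ab : a <= b by rewrite ler_pM2l// lef_pV2 ?posrE; lra.
have b3 : 3 * b < 1 by rewrite mulrA ltr_pdivrMr; lra.
have eb1 : 1 + b <= expR b := expR_ge1Dx b.
have eb2 : expR b <= (1 - b)^-1.
  have := expR_ge1Dx (- b); rewrite expRN => h.
  by rewrite -[expR b]invrK lef_pV2 ?posrE ?invr_gt0 ?expR_gt0//; lra.
have b1 : (1 - b)^-1 < 2.
  by rewrite -div1r ltr_pdivrMr; lra.
have in_ge : s / (1 + 2 * s) <= ln (1 + a).
  have a1 : 0 < 1 + a by rewrite addr_gt0.
  have -> : s / (1 + 2 * s) = 1 - (1 + a)^-1.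
    by rewrite /a; field; lra.
  have := @le_ln1Dx R ((1 + a)^-1 - 1).
  rewrite [1 + (_ - 1)]addrC subrK lnV ?posrE// ltrBDr addNr invr_gt0 a1.
  by move=> /(_ isT); lra.
have in_gt0 : 0 < ln (1 + a).
  by apply: lt_le_trans in_ge; rewrite divr_gt0//; lra.
apply/andP; split.
  rewrite ler_pdivlMr// !mul1r ler_ln ?posrE ?invr_gt0//; try lra.
  apply: (@le_trans _ _ (1 + b)); first lra.
  rewrite -[X in _ <= X]div1r ler_pdivlMr; last by lra.
  have : 0 <= (1 + b) * (expR b - (1 + b)) by apply: mulr_ge0; lra.
  by have := sqr_ge0 b; lra.
have out_le : ln (1 / (2 - expR b)) <= s / (1 - 3 * s).
  have -> : s / (1 - 3 * s) = (2 - (1 - b)^-1)^-1 - 1.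
    by rewrite /b; field; lra.
  apply: (@le_trans _ _ (1 / (2 - expR b) - 1)).
    rewrite -{1}(subrK 1 (1 / _)) addrC; apply: le_ln1Dx.
    by rewrite ltrBDr addNr divr_gt0//; lra.
  by rewrite lerD2r div1r lef_pV2 ?posrE; lra.
rewrite ler_pdivrMr//; apply: (le_trans out_le).
have -> : s / (1 - 3 * s) = (1 + 2 * s) / (1 - 3 * s) * (s / (1 + 2 * s)).
  by field; lra.
by rewrite ler_pM2l// divr_gt0//; lra.
Qed.

Lemma cvg_radius_ratio (R : realType) (d : R) : 0 < d ->
  outer_radius d t / inner_radius d t @[t --> 0^'+] --> (1 : R).
Proof.
move=> d0.
apply: (@squeeze_cvgr _ _ _ _ (fun=> 1)
  (fun t => (1 + 2 * (t * d)) / (1 - 3 * (t * d)))).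
- near=> t; apply: radius_ratio_bounds => //.
  have : t < 4^-1 / d by near: t; apply: nbhs_right_lt; rewrite divr_gt0.
  by rewrite ltr_pdivlMr//; lra.
- exact: cvg_cst.
- apply: cvg_at_right_filter.
  have e : (1 + 2 * (0 * d)) / (1 - 3 * (0 * d)) = 1 :> R.
    by rewrite mul0r !mulr0 addr0 subr0 divr1.
  rewrite -[X in _ --> X]e.
  have ctd (k : R) : k * (t * d) @[t --> (0 : R)] --> k * (0 * d).
    apply: cvgM; first exact: cvg_cst.
    by apply: cvgM; [exact: cvg_id|exact: cvg_cst].
  apply: cvgM; first by apply: cvgD; [exact: cvg_cst|exact: ctd].
  apply: cvgV; first by rewrite mul0r mulr0 subr0.
  by apply: cvgB; [exact: cvg_cst|exact: ctd].
Unshelve. all: by end_near. Qed.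

(** * The inclusions of balls *)

(** With [s := t * bdist D x], the bound on [quasihyperbolic D x y] gives
    [enorm (x - y) < bdist D x * s / (1 + s)], and the value of
    [r / (bdist D x * (bdist D x - r))] at [r = bdist D x * s / (1 + s)] is
    exactly [t]. *)
Lemma sub_ball_k_ball_c (R : realType) (n : nat) (D : set 'rV[R]_n)
    (x : 'rV[R]_n) (t : R) : open D -> D <> setT -> D x -> 0 < t ->
  ball_k D x (inner_radius (bdist D x) t) `<=` ball_c D x t.
Proof.
move=> oD DT Dx t0 y [Dy ky]; split => //.
have bD := bdry_neq0 oD DT Dx; have d0 := bdist_gt0 oD bD Dx.
have := le_lt_trans (ln_le_quasihyperbolic y oD DT Dx) ky.
rewrite /inner_radius enorm_distC; have r0 := enorm_ge0 (x - y).
have td0 : 0 < t * bdist D x by rewrite mulr_gt0.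
have den0 : 0 < 1 + t * bdist D x by rewrite addr_gt0.
rewrite lte_fin ltr_ln ?posrE; last 2 first.
  - by rewrite ltr_pwDl// divr_ge0// ltW.
  - by rewrite addr_gt0// divr_gt0.
rewrite ltrD2l ltr_pdivrMr// mulrAC ltr_pdivlMr// => small.
have rd : enorm (x - y) < bdist D x.
  rewrite -(ltr_pM2r den0); apply: (lt_le_trans small).
  by rewrite mulrC ler_pM2l// lerDr.
apply: le_lt_trans (cassinian_le bD rd) _.
rewrite ltr_pdivrMr ?mulr_gt0 ?subr_gt0//.
by move: small; set r := enorm _; set d := bdist D x; lra.
Qed.

(** The argument yields the radius [- ln (1 - s)] with
    [s = t * bdist D x / (1 - t * bdist D x)]; the outer radius is larger
    because [2 - expR s <= 1 - s]. *)
Lemma sub_ball_c_ball_k (R : realType) (n : nat) (D : set 'rV[R]_n)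
    (x : 'rV[R]_n) (t : R) : open D -> D <> setT -> D x -> 0 < t ->
  t < ln 2 / (bdist D x * (1 + ln 2)) ->
  ball_c D x t `<=` ball_k D x (outer_radius (bdist D x) t).
Proof.
move=> oD DT Dx t0 tlt y [Dy cy]; split => //.
have bD := bdry_neq0 oD DT Dx; have d0 := bdist_gt0 oD bD Dx.
have ln2 : 0 < ln 2 :> R by rewrite ln_gt0// ltr1n.
have e2 : expR (ln 2) = 2 :> R by rewrite lnK// posrE.
have ln2lt : ln 2 < 1 :> R.
  have := @expR_gt1Dx R (ln 2); rewrite e2 gt_eqF// => /(_ isT); lra.
have := dist_lt_of_cassinian_lt oD bD Dx Dy t0 cy.
move: tlt; rewrite /outer_radius enorm_distC ltr_pdivlMr ?mulr_gt0 ?addr_gt0//.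
have r0 := enorm_ge0 (y - x).
have := @quasihyperbolic_le_ln _ _ _ _ y oD DT Dx.
move: r0 d0; set r := enorm _; set d := bdist D x => r0 d0 kle tlt rlt.
have td0 : 0 < t * d by rewrite mulr_gt0.
have td1 : t * d < 1 by nra.
(* The bound on [t] amounts to [expR s < 2] for [s] as below, which makes the
   outer radius the logarithm of a positive number. *)
have sln : t * d / (1 - t * d) < ln 2.
  by rewrite ltr_pdivrMr ?subr_gt0//; lra.
have rds : r / d < t * d / (1 - t * d).
  rewrite ltr_pdivrMr// mulrAC ltr_pdivlMr ?subr_gt0//; lra.
set s := t * d / (1 - t * d) in sln rds *.
have rd1 : r / d < 1 by lra.
have rd : r < d by move: rd1; rewrite ltr_pdivrMr// mul1r.
apply: (le_lt_trans (kle rd)); rewrite lte_fin.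
have es2 : expR s < 2 by rewrite -e2 ltr_expR.
rewrite div1r lnV ?posrE ?subr_gt0// ltrN2 ltr_ln ?posrE ?subr_gt0//.
by have := expR_ge1Dx s; lra.
Qed.

Theorem theorem5p14 (R : realType) (n : nat) (hn : (2 <= n)%N)
    (D : set 'rV[R]_n) (hD : domain D) (hDT : D <> setT)
    (x : 'rV[R]_n) (hx : D x) :
  (forall t : R, 0 < t -> t < ln 2 / (bdist D x * (1 + ln 2)) ->
     ball_k D x (inner_radius (bdist D x) t) `<=` ball_c D x t /\
     ball_c D x t `<=` ball_k D x (outer_radius (bdist D x) t)) /\
  (outer_radius (bdist D x) t / inner_radius (bdist D x) t
     @[t --> 0^'+] --> (1 : R)).
Proof.
have [oD _ _] := hD; split=> [t t0 tlt|].
  by split; [exact: sub_ball_k_ball_c|exact: sub_ball_c_ball_k].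
exact: cvg_radius_ratio (bdist_gt0 oD (bdry_neq0 oD hDT hx) hx).
Qed.
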